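(* Let $q=5^{\alpha}$ with $\alpha\ge 1$, and let $D=(P,B)$ and $G=\operatorname{PSL}(2,q)$ be as in the context. Then $D$ is a $\mathrm{GPBIBD}(m)$ with parameters $$v=\frac{q^2-1}{4},\quad b=\frac{q(q^2-1)}{120},\quad k=6,\quad r=\frac{q}{5}=5^{\alpha-1},\quad \lambda_1=1,\quad \lambda_2=\dots=\lambda_m=0,$$ whose underlying association scheme is the Schurian scheme $\mathcal{S}(G,P)$ of the action of $G$ on $P$, and the number of associate classes is $m=\frac{q-3}{2}$.
   Context: Let $\omega$ be a generator of $\mathbb{F}_q^{\times}$ and $i=\omega^{(q-1)/4}$. Let $P=(\mathbb{F}_q^2\setminus\{0\})/\langle i\rangle$ (nonzero column vectors with $\pi,-\pi,i\pi,-i\pi$ identified). $G=\operatorname{PSL}(2,q)=\operatorname{SL}(2,q)/\{\pm I\}$ acts on $P$ by multiplying representatives. Let $T\subseteq P$ be the set of classes of $\binom{1}{0},\binom{0}{1},\binom{1}{1},\binom{1+i}{1},\binom{i}{1},\binom{1}{1-i}$, $B=\{gT:g\in G\}$, and $D=(P,B)$ the incidence structure with points $P$ and blocks $B$. An association scheme with $m$ classes on a finite set $X$ is a partition of $X\times X$ into relations $R_0,\dots,R_m$ with $R_0=\{(x,x)\}$, each $R_j^{-1}$ again one of the relations, and such that for $(x,z)\in R_k$ the number of $y$ with $(x,y)\in R_i,(y,z)\in R_j$ depends only on $i,j,k$. The Schurian scheme $\mathcal{S}(G,P)$ has as relations the orbits of $G$ on $P\times P$. A $\mathrm{GPBIBD}(m)$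 with parameters $v,b,k,r,\lambda_1,\dots,\lambda_m$ is a block design with $v$ points and $b$ blocks, each block of size $k$, each point on $r$ blocks, together with an association scheme (not necessarily symmetric) with classes $R_0,\dots,R_m$ on the point set such that for each $1\le j\le m$ any pair $(x,y)\in R_j$ lies together in exactly $\lambda_j$ blocks (for a suitable numbering of the non-identity classes). *)

(* Defs.v *)
From HB Require Import structures.
From mathcomp Require Import all_boot all_order all_algebra all_fingroup all_solvable.

Set Implicit Arguments.
Unset Strict Implicit.
Unset Printing Implicit Defensive.

Import GroupScope GRing.Theory.
Local Open Scope ring_scope.

Section Schemes.

Variables (T : finType) (m : nat).

(* Injectivity together with [partition] (whose blocks are nonempty) says that
   the m + 1 relations are pairwise distinct and nonempty. *)
Record association_scheme (R : 'I_m.+1 -> {set T * T}) : Prop :=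
  AssociationScheme {
    scheme_inj : injective R;
    scheme_partition : partition [set R j | j : 'I_m.+1] [set: T * T];
    scheme_diag : R ord0 = [set (x, x) | x : T];
    scheme_inv : forall j : 'I_m.+1,
      exists j' : 'I_m.+1, R j' = [set (p.2, p.1) | p in R j];
    scheme_num : forall i j k : 'I_m.+1, exists c : nat,
      forall x z : T, (x, z) \in R k ->
        #|[set y | ((x, y) \in R i) && ((y, z) \in R j)]| = c
  }.

(* Only the values [lam 1], ..., [lam m] are constrained. *)
Record GPBIBD (B : {set {set T}}) (R : 'I_m.+1 -> {set T * T})
    (v b k r : nat) (lam : nat -> nat) : Prop :=
  MkGPBIBD {
    gpbibd_scheme : association_scheme R;
    gpbibd_v : #|T| = v;
    gpbibd_b : #|B| = b;
    gpbibd_k : forall blk : {set T}, blk \in B -> #|blk| = k;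
    gpbibd_r : forall x : T, #|[set blk in B | x \in blk]| = r;
    gpbibd_lam : forall j : 'I_m.+1, (1 <= j)%N ->
      forall x y : T, (x, y) \in R j ->
        #|[set blk in B | (x \in blk) && (y \in blk)]| = lam j
  }.

End Schemes.

Section PairAction.

Variables (aT : finGroupType) (D : {set aT}) (T : finType) (to : action D T).

Definition pact (p : T * T) (a : aT) : T * T := (to p.1 a, to p.2 a).

Lemma pact_is_action : is_action D pact.
Proof.
split=> [a [x y] [x' y'] [/act_inj-> /act_inj->] // | [x y] a b Da Db].
by rewrite /pact /= !actMin.
Qed.

Canonical pair_action : action D (T * T)%type := Action pact_is_action.

Definition schurian_relations (G : {set aT}) : {set {set T * T}} :=
  [set orbit pair_action G p | p : T * T].

End PairAction.

Section Groups.

Variable F : finFieldType.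

Definition SL2_set : {set {'GL_2[F]}} := [set A | \det (GLval A) == 1].

Lemma SL2_group_set : group_set SL2_set.
Proof.
apply/group_setP; split; first by rewrite inE det1.
by move=> A B; rewrite !inE GL_MxE det_mulmx => /eqP-> /eqP->; rewrite mulr1.
Qed.

Canonical SL2 : {group {'GL_2[F]}} := Group SL2_group_set.

Definition pmI_set : {set {'GL_2[F]}} :=
  [set A | (GLval A == 1%:M) || (GLval A == - 1%:M)].

Lemma pmI_group_set : group_set pmI_set.
Proof.
apply/group_setP; split; first by rewrite inE eqxx.
by move=> A B; rewrite !inE GL_MxE => /orP[]/eqP-> /orP[]/eqP->;
   rewrite ?mulNmx ?mulmxN ?mul1mx ?opprK eqxx ?orbT.
Qed.

Canonical pmI : {group {'GL_2[F]}} := Group pmI_group_set.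

Definition PSL2 : {group coset_of pmI} := (SL2 / pmI)%G.

Lemma pmI_sub_SL2 : pmI \subset SL2.
Proof.
apply/subsetP=> A; rewrite !inE => /orP[]/eqP->; rewrite ?det1 //.
by rewrite -scaleN1r detZ det1 mulr1 sqrrN expr1n.
Qed.

Lemma pmI_norm (A : {'GL_2[F]}) : A \in 'N(pmI).
Proof.
apply: (subsetP (cent_sub _)); apply/centP=> B; rewrite inE => BI.
apply: val_inj; change (GLval (A * B)%g = GLval (B * A)%g); rewrite !GL_MxE.
by case/orP: BI => /eqP->; rewrite ?mulNmx ?mulmxN mul1mx mulmx1.
Qed.

End Groups.

Section Points.

Variables (F : finFieldType) (i : {unit F}).

Definition ray (v : 'cV[F]_2) : {set 'cV[F]_2} :=
  [set FinRing.uval z *: v | z in <[i]>].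

Definition rays : {set {set 'cV[F]_2}} :=
  [set ray v | v : 'cV[F]_2 & v != 0].

Definition point : Type := {p : {set 'cV[F]_2} | p \in rays}.
HB.instance Definition _ := Finite.on point.

Lemma imset_ray (A : 'M[F]_2) (v : 'cV[F]_2) :
  [set A *m u | u in ray v] = ray (A *m v).
Proof. by rewrite -imset_comp; apply: eq_imset => z /=; rewrite scalemxAr. Qed.

Lemma glact_subproof (p : point) (A : {'GL_2[F]}) :
  [set GLval A^-1 *m u | u in val p] \in rays.
Proof.
case: p => p /= /imsetP[v]; rewrite inE => v0 ->; rewrite imset_ray.
apply: imset_f; rewrite inE; apply: contraNneq v0 => Av0.
by rewrite -(mul1mx v) -[1%:M](congr1 GLval (mulgV A)) GL_MxE -mulmxA Av0 mulmx0.
Qed.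

(* MathComp actions are right actions, so left multiplication of vectors by
   matrices is turned into a right action by inverting the matrix; over a group
   this changes neither orbits nor the set of translates {gT : g \in G}. *)
Definition glact (p : point) (A : {'GL_2[F]}) : point :=
  exist _ [set GLval A^-1 *m u | u in val p] (glact_subproof p A).

Lemma glact1 : glact^~ 1%g =1 id.
Proof.
move=> p; apply: val_inj; rewrite -[RHS]imset_id.
by apply: eq_imset => u; rewrite invg1 mul1mx.
Qed.

Lemma glactM p : act_morph glact p.
Proof.
move=> A B; apply: val_inj; rewrite -[RHS]imset_comp.
by apply: eq_imset => u; rewrite invMg GL_MxE -mulmxA.
Qed.

Canonical gl_action : {action {'GL_2[F]} &-> point} := TotalAction glact1 glactM.

(* The library's [%%] sends the coset of A to the action of A on those points
   that are fixed by the kernel {I, -I}; when -1 is a power of i, all of them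
   are (see [psl_actionE] and [sqrtN1_sqr] below). *)
Definition psl_action : action _ point := (gl_action %% pmI F)%act.

Lemma psl_actionE (p : point) (A : {'GL_2[F]}) (v : 'cV[F]_2) :
  (exists2 z, z \in <[i]> & FinRing.uval z = -1) ->
  val p = ray v ->
  val (psl_action p (coset (pmI F) A)) = ray (GLval A^-1 *m v).
Proof.
case=> z iz zN1 pv.
rewrite /psl_action /= modactE ?in_setT ?pmI_norm //= ?pv ?imset_ray //.
apply/afixP=> B; rewrite setTI => BI; apply: val_inj.
have {BI} : (B^-1)%g \in pmI F by rewrite groupV.
rewrite inE -[RHS]/(val p) -[LHS]/[set GLval B^-1 *m u | u in val p] pv imset_ray => /orP[]/eqP->.
  by rewrite mul1mx.
rewrite mulNmx mul1mx -scaleN1r -zN1; apply/setP=> u.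
apply/imsetP/imsetP=> [] [y iy ->].
  by exists (y * z)%g; rewrite ?groupM // scalerA.
exists (y * z^-1)%g; rewrite ?groupM ?groupV //.
by rewrite scalerA -[_ * _]/(FinRing.uval (y * z^-1 * z)%g) mulgVK.
Qed.

Definition vec (a b : F) : 'cV[F]_2 := \col_(j < 2) if j == ord0 then a else b.

Definition base_block : {set point} :=
  let e : F := FinRing.uval i in
  [set p : point | val p \in
     [seq ray v | v <- [:: vec 1 0; vec 0 1; vec 1 1;
                           vec (1 + e) 1; vec e 1; vec 1 (1 - e)]]].

Definition blocks : {set {set point}} := orbit (psl_action^*)%act (PSL2 F) base_block.

End Points.

Definition sqrtN1 (F : finFieldType) (w : {unit F}) : {unit F} :=
  (w ^+ (#|F|.-1 %/ 4))%g.

Lemma sqrtN1_sqr (F : finFieldType) (w : {unit F}) :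
  generator [set: {unit F}] w -> (4 %| #|F|.-1)%N ->
  FinRing.uval (sqrtN1 w ^+ 2)%g = -1.
Proof.
move=> /eqP genw d4; have ow : #[w]%g = #|F|.-1.
  by rewrite /order -genw card_finField_unit.
have q1 : (0 < #|F|.-1)%N by rewrite -ow order_gt0.
have w4: (sqrtN1 w ^+ 2 ^+ 2 = 1)%g.
  by rewrite -expgM /sqrtN1 -expgM divnK // -ow expg_order.
have: FinRing.uval (sqrtN1 w ^+ 2)%g ^+ 2 == 1.
  by rewrite -FinRing.val_unitX w4.
rewrite sqrf_eq1 => /orP[]/eqP // h.
have: (w ^+ (#|F|.-1 %/ 4 * 2) == 1)%g by apply/eqP/val_inj; rewrite expgM.
rewrite -order_dvdn ow -[X in (X %| _)%N](divnK d4) dvdn_pmul2l //.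
by rewrite divn_gt0 // dvdn_leq.
Qed.

(* The quotients in the parameters are exact. *)
Lemma parameters_exact (alpha : nat) (q := (5 ^ alpha)%N) : (0 < alpha)%N ->
  [/\ 4 %| q.-1, 4 %| q ^ 2 - 1, 120 %| q * (q ^ 2 - 1), 5 %| q & 2 %| q - 3]%N.
Proof.
case: alpha @q => // a q _.
have q1 : (q %% 4 = 1)%N by rewrite -modnXm exp1n.
have q24 : (24 %| q ^ 2 - 1)%N.
  rewrite -eqn_mod_dvd ?expn_gt0 // -expnM mulnC expnM.
  by rewrite -modnXm exp1n.
have q5 : (5 %| q)%N by rewrite /q expnS dvdn_mulr.
have q_gt : (5 <= q)%N by rewrite dvdn_leq // expn_gt0.
split=> //.
- by rewrite -subn1 -eqn_mod_dvd ?q1 // (leq_trans _ q_gt).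
- exact: dvdn_trans q24.
- exact: (dvdn_mul q5 q24).
- by rewrite dvdn2 oddB ?(leq_trans _ q_gt) // oddX.
Qed.

(* Main.v *)
Require Import Defs.
From HB Require Import structures.
From mathcomp Require Import all_boot all_order all_algebra all_fingroup all_solvable.
From mathcomp Require finfield.
From mathcomp Require Import ring zify.

(** In characteristic 5 the powers of [i] are exactly the nonzero elements of
    F_5, so a point is a nonzero vector up to F_5^*, the base block is the
    projective line of F_5^2, and the blocks are its images under SL(2, q).

    Orbits on pairs of points: SL(2, q) is transitive on pairs (u, v) with given
    determinant [wedge u v]; a pair with nonzero determinant d is determined up
    to the action by d mod F_5^*, and a pair (u, c u) by c mod F_5^*, that is by
    the fourth powers of d and c. This gives 2 (q - 1) / 4 orbits, one of which
    is the diagonal.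

    If two distinct points (u, v) lie on a block, the determinant is in F_5^*;
    conversely if it is, the F_5-span of u and v is the only block containing
    them. So lambda is 1 on a single relation, of valency q, and 0 on the others;
    double counting gives 5 r = q and 6 b = v r. *)

Section PSL2Design.

Set Implicit Arguments.
Unset Strict Implicit.
Unset Printing Implicit Defensive.

Import GroupScope GRing.Theory.
Local Open Scope ring_scope.

(** * Orbits of a group on pairs as an association scheme *)

Section Schurian.

(** A group element carrying [(x0, z0)] to [(x, z)] maps the intermediate points of the first pair
    bijectively onto those of the second, which makes the intersection numbers constant. The
    converse of the orbit of [(x, y)] is the orbit of [(y, x)]. *)
Lemma orbits_association_scheme (aT : finGroupType) (D : {group aT})
    (T : finType) (to : action D T) (G : {group aT}) (m : nat)
    (R : 'I_m.+1 -> {set T * T}) :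
  G \subset D -> injective R ->
  [set R j | j : 'I_m.+1] = schurian_relations to G ->
  R ord0 = [set (x, x) | x : T] ->
  association_scheme R.
Proof.
move=> sGD injR imR R0.
have orbR j : exists p, R j = orbit (pair_action to) G p.
  have /imsetP[p _ ->] : R j \in schurian_relations to G by rewrite -imR imset_f.
  by exists p.
have Rorb p : exists j, R j = orbit (pair_action to) G p.
  have : orbit (pair_action to) G p \in schurian_relations to G by exact: imset_f.
  by rewrite -imR => /imsetP[j _ ->]; exists j.
have Ract j a x y : a \in G -> ((to x a, to y a) \in R j) = ((x, y) \in R j).
  move=> Ga; have [p ->] := orbR j.
  exact: (@orbit_actr_in _ _ _ (pair_action to) p a G (x, y) sGD Ga).
split=> //.
- rewrite imR /schurian_relations.
  have -> : [set orbit (pair_action to) G p | p : T * T] =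
            orbit (pair_action to) G @: [set: T * T].
    by apply/setP=> S; apply/imsetP/imsetP=> -[p _ ->]; exists p; rewrite ?inE.
  by apply: orbit_partition; apply/subsetP=> a Ga; rewrite !inE (subsetP sGD) //;
     apply/subsetP=> p _; rewrite !inE.
- move=> j; have [[x y] ->] := orbR j; have [j' Rj'] := Rorb (y, x).
  exists j'; rewrite Rj'.
  apply/setP=> p; apply/orbitP/imsetP.
    by case=> a Ga <-; exists (to x a, to y a) => //; apply/orbitP; exists a.
  by case=> _ /orbitP[a Ga <-] ->; exists a.
- move=> i j k; have [[x0 z0] Rk] := orbR k.
  exists #|[set y | ((x0, y) \in R i) && ((y, z0) \in R j)]| => x z.
  rewrite Rk => /orbitP[a Ga [<- <-]].
  rewrite -[RHS](card_imset _ (act_inj to a)); apply: eq_card => y.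
  rewrite inE; apply/idP/imsetP => [H|[y' /[!inE] H ->]]; last by rewrite !Ract.
  have Da : a^-1%g \in G by rewrite groupV.
  exists (to y a^-1%g); rewrite ?(actKVin to) ?(subsetP sGD) // inE.
  by rewrite -(Ract i a) // -(Ract j a) // (actKVin to) ?(subsetP sGD).
Qed.

(** Serves to number the relations so that the diagonal gets index 0 and the relation with lambda
    equal to 1 gets index 1. *)
Lemma enum_starting_with (T : finType) (S : {set T}) (m : nat) (a b : T) :
  #|S| = m.+1 -> (0 < m)%N -> a \in S -> b \in S -> a != b ->
  exists R : 'I_m.+1 -> T, [/\ injective R, [set R j | j : 'I_m.+1] = S,
    R ord0 = a & forall j : 'I_m.+1, (R j == b) = (j == 1%N :> nat)].
Proof.
move=> cS m0 Sa Sb ab; pose s := a :: b :: enum (S :\ a :\ b).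
have us : uniq s.
  by rewrite /= inE !mem_enum enum_uniq !inE !eqxx /= negb_or ab andbF.
have ms : s =i S.
  move=> x; rewrite !inE mem_enum !inE.
  by case: eqVneq => [->|_] //=; case: eqVneq => [->|].
have ss : size s = m.+1 by rewrite -cS -(card_uniqP us); apply: eq_card.
have inj : injective (fun j : 'I_m.+1 => nth a s j).
  by move=> j k /eqP; rewrite nth_uniq ?ss // => /eqP /val_inj.
exists (fun j => nth a s j); split=> //.
  apply/setP=> x; rewrite -ms; apply/imsetP/idP=> [[j _ ->]|].
    by rewrite mem_nth ?ss.
  move/(nthP a)=> [j]; rewrite ss => lj <-; exists (Ordinal lj) => //.
by move=> j; rewrite -[X in _ == X]/(nth a s 1) nth_uniq ?ss.
Qed.

End Schurian.

(** * Determinants of pairs of vectors and SL(2, F) on the plane *)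

Section Plane.

Variable F : finFieldType.
Implicit Types (u v : 'cV[F]_2) (M : 'M[F]_2) (A : {'GL_2[F]}).

Lemma ord2P (P : 'I_2 -> Prop) : P 0 -> P 1 -> forall k, P k.
Proof.
move=> P0 P1; case=> -[|[|//]] lk; [move: P0|move: P1]; congr P; exact: val_inj.
Qed.

Lemma vecE0 (a b : F) : vec a b 0 0 = a. Proof. by rewrite mxE. Qed.
Lemma vecE1 (a b : F) : vec a b 1 0 = b. Proof. by rewrite mxE. Qed.

Lemma colP2 u v : u 0 0 = v 0 0 -> u 1 0 = v 1 0 -> u = v.
Proof. by move=> e0 e1; apply/colP; apply: ord2P. Qed.

Lemma col2_neq0 v : (v != 0) = (v 0 0 != 0) || (v 1 0 != 0).
Proof.
apply/idP/idP; last first.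
  by apply: contraTneq => ->; rewrite !mxE eqxx.
by apply: contraR; rewrite negb_or !negbK => /andP[/eqP e0 /eqP e1];
   apply/eqP/colP2; rewrite mxE.
Qed.

Lemma det_mx22 M : \det M = M 0 0 * M 1 1 - M 0 1 * M 1 0.
Proof.
rewrite (expand_det_row _ 0) !big_ord_recl big_ord0 /cofactor !det_mx11 !mxE.
have -> : lift 0 (0 : 'I_1) = 1 :> 'I_2 by apply: val_inj.
have -> : lift (1 : 'I_2) (0 : 'I_1) = 0 :> 'I_2 by apply: val_inj.
by rewrite /= expr0 expr1; ring.
Qed.

Lemma mulmx_col2 M v k : (M *m v) k 0 = M k 0 * v 0 0 + M k 1 * v 1 0.
Proof.
rewrite mxE !big_ord_recl big_ord0 addr0.
by have -> : lift 0 (0 : 'I_1) = 1 :> 'I_2 by apply: val_inj.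
Qed.

(** The determinant of the matrix with columns [u] and [v]. *)
Definition wedge u v : F := u 0 0 * v 1 0 - v 0 0 * u 1 0.

Lemma wedge_mul M u v : wedge (M *m u) (M *m v) = \det M * wedge u v.
Proof. by rewrite /wedge !mulmx_col2 det_mx22; ring. Qed.

Lemma wedgeZl c u v : wedge (c *: u) v = c * wedge u v.
Proof. by rewrite /wedge !mxE; ring. Qed.

Lemma wedgeZr c u v : wedge u (c *: v) = c * wedge u v.
Proof. by rewrite /wedge !mxE; ring. Qed.

Lemma wedge_neq0l u v : wedge u v != 0 -> u != 0.
Proof. by apply: contraNneq => ->; rewrite /wedge !mxE; apply/eqP; ring. Qed.

Lemma wedge_neq0r u v : wedge u v != 0 -> v != 0.
Proof. by apply: contraNneq => ->; rewrite /wedge !mxE; apply/eqP; ring. Qed.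

Lemma wedge_eq0 u v : u != 0 -> wedge u v = 0 -> exists c, v = c *: u.
Proof.
rewrite col2_neq0 /wedge => /orP[] u0 e.
- exists (v 0 0 / u 0 0); apply: colP2; rewrite mxE; first by rewrite divfK.
  apply: (mulfI u0); rewrite mulrA mulrCA divff // mulr1.
  by apply/eqP; rewrite -subr_eq0 e.
- exists (v 1 0 / u 1 0); apply: colP2; rewrite mxE; last by rewrite divfK.
  apply: (mulIf u0); rewrite mulrAC divfK // mulrC.
  by apply/eqP; rewrite eq_sym -subr_eq0 [v 1 0 * _]mulrC [u 1 0 * _]mulrC e.
Qed.

(** Cramer's rule for a basis of determinant 1. *)
Lemma wedge_decomp u v t : wedge u v = 1 -> 
  t = wedge t v *: u + wedge u t *: v.
Proof.
rewrite /wedge => e; apply: colP2; rewrite !mxE.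
- by transitivity (t 0 0 * (u 0 0 * v 1 0 - v 0 0 * u 1 0)); [rewrite e mulr1|ring].
- by transitivity (t 1 0 * (u 0 0 * v 1 0 - v 0 0 * u 1 0)); [rewrite e mulr1|ring].
Qed.

Lemma exists_wedge1 u : u != 0 -> exists v, wedge u v = 1.
Proof.
rewrite col2_neq0 => /orP[] u0.
- by exists (vec 0 (u 0 0)^-1); rewrite /wedge vecE0 vecE1 mul0r subr0 divff.
- exists (vec (- (u 1 0)^-1) 0); rewrite /wedge vecE0 vecE1 mulr0 sub0r mulNr opprK.
  by rewrite mulVf.
Qed.

Lemma GLvalVK A v : GLval A *m (GLval A^-1 *m v) = v.
Proof. by rewrite mulmxA -GL_MxE mulgV mul1mx. Qed.

Lemma GLvalKV A v : GLval A^-1 *m (GLval A *m v) = v.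
Proof. by rewrite mulmxA -GL_MxE mulVg mul1mx. Qed.

Lemma GL_neq0 A v : (GLval A *m v != 0) = (v != 0).
Proof.
apply/idP/idP; apply: contraNneq; first by move->; rewrite mulmx0.
by move=> e; rewrite -(GLvalKV A v) e mulmx0.
Qed.

Lemma SL2_wedge A u v : A \in SL2 F -> wedge (GLval A *m u) (GLval A *m v) = wedge u v.
Proof. by rewrite inE wedge_mul => /eqP->; rewrite mul1r. Qed.

(** Take the matrix with columns [u] and [v]. It moves the standard basis to any given basis of
    determinant 1. *)
Lemma SL2_columns u v : wedge u v = 1 -> exists2 A, A \in SL2 F &
  forall a b, GLval A *m vec a b = a *: u + b *: v.
Proof.
move=> e; pose M : 'M[F]_2 := \matrix_(k, l) if l == 0 then u k 0 else v k 0.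
have dM : \det M = 1 by rewrite det_mx22 !mxE /=.
have uM : M \in unitmx by rewrite unitmxE dM unitr1.
exists (Sub M uM : {'GL_2[F]}); first by rewrite inE; apply/eqP.
move=> a b; apply: colP2; rewrite mulmx_col2 vecE0 vecE1 !mxE /=; ring.
Qed.

End Plane.

(** * Points as classes of vectors, and the orbits on pairs of points *)

Section Points.

Variables (F : finFieldType) (i : {unit F}).
Hypothesis i2 : FinRing.uval i ^+ 2 = -1.
Implicit Types (u v : 'cV[F]_2) (A : {'GL_2[F]}) (p x y : point i).
Local Notation e := (FinRing.uval i).

Lemma i4 : e ^+ 4 = 1.
Proof. by rewrite (exprM e 2 2) i2 sqrrN expr1n. Qed.

Lemma expr4_eq1 (c : F) :
  (c ^+ 4 == 1) = [|| c == 1, c == -1, c == e | c == - e].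
Proof.
have -> : (c ^+ 4 == 1) = ((c - 1) * (c + 1) * ((c - e) * (c + e)) == 0).
  rewrite -subr_eq0; congr (_ == 0).
  transitivity ((c ^+ 2 - 1) * (c ^+ 2 - e ^+ 2)); last by ring.
  by rewrite i2; ring.
by rewrite !mulf_eq0 !subr_eq0 !addr_eq0 -!orbA.
Qed.

(** The four powers of [i] are the four roots of X^4 - 1, so membership in the cyclic group becomes
    a polynomial equation. *)
Lemma mem_cycle_i (c : F) :
  (exists2 z, z \in <[i]> & FinRing.uval z = c) <-> c ^+ 4 = 1.
Proof.
split=> [[z /cycleP[n ->] <-]|/eqP].
  by rewrite FinRing.val_unitX exprAC i4 expr1n.
rewrite expr4_eq1 => /or4P[] /eqP->.
- by exists 1%g; rewrite ?group1.
- by exists (i ^+ 2)%g; rewrite ?mem_cycle // FinRing.val_unitX.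
- by exists i; rewrite ?cycle_id.
- exists (i ^+ 3)%g; rewrite ?mem_cycle // FinRing.val_unitX exprS i2.
  by rewrite mulrN1.
Qed.

Lemma mem_ray u v : u \in ray i v <-> exists2 c, c ^+ 4 = 1 & u = c *: v.
Proof.
split=> [/imsetP[z zi ->]|[c /mem_cycle_i[z zi <-] ->]].
  by exists (FinRing.uval z) => //; apply/mem_cycle_i; exists z.
exact: imset_f.
Qed.

Lemma ray_eq u v : ray i u = ray i v <-> exists2 c, c ^+ 4 = 1 & u = c *: v.
Proof.
split=> [e0|[c c4 ->]].
  by apply/mem_ray; rewrite -e0; apply/mem_ray; exists 1; rewrite ?expr1n ?scale1r.
have c0 : c != 0 by apply/eqP=> c0; move/eqP: c4; rewrite c0 expr0n eq_sym oner_eq0.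
apply/setP=> t; apply/idP/idP=> /mem_ray[d d4 ->]; apply/mem_ray.
  by exists (d * c); rewrite ?exprMn ?d4 ?c4 ?mulr1 // scalerA.
exists (d / c); first by rewrite exprMn exprVn d4 c4 invr1 mulr1.
by rewrite scalerA divfK.
Qed.

Lemma vec10_neq0 : vec 1 0 != 0 :> 'cV[F]_2.
Proof. by rewrite col2_neq0 vecE0 oner_eq0. Qed.

Lemma vec01_neq0 : vec 0 1 != 0 :> 'cV[F]_2.
Proof. by rewrite col2_neq0 vecE1 oner_eq0 orbT. Qed.

Lemma ray_rays v : v != 0 -> ray i v \in rays i.
Proof. by move=> v0; apply: imset_f; rewrite inE. Qed.

(** Made total by sending the zero vector to the class of [vec 1 0]; hence the conditions [v != 0]
    in later lemmas. *)
Definition pt v : point i :=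
  insubd (exist (fun s => s \in rays i) (ray i (vec 1 0)) (ray_rays vec10_neq0))
    (ray i v).

Lemma val_pt v : v != 0 -> val (pt v) = ray i v.
Proof. by move=> v0; rewrite val_insubd ray_rays. Qed.

Lemma ptP p : exists2 v, v != 0 & p = pt v.
Proof.
have /imsetP[v] := valP p; rewrite inE => v0 e0; exists v => //.
by apply: val_inj; rewrite val_pt.
Qed.

Lemma pt_eq u v : u != 0 -> v != 0 ->
  pt u = pt v <-> exists2 c, c ^+ 4 = 1 & u = c *: v.
Proof.
move=> u0 v0; split=> [/(congr1 val)|/ray_eq e0]; first by rewrite !val_pt // => /ray_eq.
by apply: val_inj; rewrite !val_pt.
Qed.

Lemma expr4_neq0 (c : F) : c ^+ 4 = 1 -> c != 0.
Proof. by apply: contra_eqN => /eqP->; rewrite expr0n /= eq_sym oner_eq0. Qed.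

Lemma pt_scale c v : c ^+ 4 = 1 -> v != 0 -> pt (c *: v) = pt v.
Proof.
move=> c4 v0; apply/pt_eq => //; last by exists c.
by rewrite scaler_eq0 negb_or v0 expr4_neq0.
Qed.

Lemma psl_pt v A : v != 0 ->
  psl_action i (pt v) (coset (pmI F) A) = pt (GLval A^-1 *m v).
Proof.
move=> v0; apply: val_inj; rewrite [RHS]val_pt ?GL_neq0 //.
(* -1 is a power of [i] because its fourth power is 1. *)
by apply: psl_actionE; rewrite ?val_pt //; apply/mem_cycle_i; rewrite -signr_odd expr0.
Qed.

Lemma PSL2P g : reflect (exists2 A, A \in SL2 F & g = coset (pmI F) A) (g \in PSL2 F).
Proof.
apply: (iffP idP) => [/morphimP[A _ AS ->]|[A AS ->]]; first by exists A.
exact: mem_quotient.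
Qed.

(** The inverse built into the right action disappears here, since [A] ranges over a group. *)
Lemma orbit_pairP u v u' v' : u != 0 -> v != 0 ->
  (pt u', pt v') \in orbit (pair_action (psl_action i)) (PSL2 F) (pt u, pt v) <->
  exists2 A, A \in SL2 F & pt u' = pt (GLval A *m u) /\ pt v' = pt (GLval A *m v).
Proof.
move=> u0 v0; split.
  case/orbitP=> _ /PSL2P[A AS ->]; rewrite /= /pact /= !psl_pt // => -[<- <-].
  by exists A^-1%g; rewrite ?groupV.
case=> A AS [-> ->]; apply/orbitP; exists (coset (pmI F) A^-1).
  by apply/PSL2P; exists A^-1%g; rewrite ?groupV.
by rewrite /= /pact /= !psl_pt // invgK.
Qed.

Lemma PSL2_dom : PSL2 F \subset ([set: {'GL_2[F]}] / pmI F)%g.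
Proof. by rewrite quotientS ?subsetT. Qed.

Local Notation orb2 u v :=
  (orbit (pair_action (psl_action i)) (PSL2 F) (pt u, pt v)).

Lemma orb2_eqP u v u' v' : u != 0 -> v != 0 ->
  orb2 u' v' = orb2 u v <->
  exists2 A, A \in SL2 F & pt u' = pt (GLval A *m u) /\ pt v' = pt (GLval A *m v).
Proof.
move=> u0 v0; rewrite -orbit_pairP //.
by split=> /(orbit_in_eqP (to := pair_action (psl_action i)) PSL2_dom).
Qed.

(** The matrix with columns [u] and [d^-1 *: v] has determinant 1 and sends [vec 1 0] to [u] and
    [vec 0 d] to [v]. *)
Lemma orb2_wedge u v d : d != 0 -> wedge u v = d ->
  orb2 u v = orb2 (vec 1 0) (vec 0 d).
Proof.
move=> d0 uv; have: wedge u (d^-1 *: v) = 1 by rewrite wedgeZr uv mulVf.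
case/SL2_columns=> A AS Ae; apply/orb2_eqP.
- exact: vec10_neq0.
- by rewrite col2_neq0 vecE1 d0 orbT.
exists A => //; rewrite !Ae !scale0r scale1r addr0 add0r scalerA divff //.
by rewrite scale1r.
Qed.

(** Complete [u] to a basis of determinant 1; the resulting matrix sends [vec 1 0] to [u], hence
    [vec c 0] to [c *: u]. *)
Lemma orb2_collinear u c : u != 0 -> c != 0 ->
  orb2 u (c *: u) = orb2 (vec 1 0) (vec c 0).
Proof.
move=> u0 c0; have [v /SL2_columns[A AS Ae]] := exists_wedge1 u0; apply/orb2_eqP.
- exact: vec10_neq0.
- by rewrite col2_neq0 vecE0 c0.
by exists A => //; rewrite !Ae !scale0r scale1r !addr0.
Qed.

(** SL(2, F) preserves the determinant, and a change of representatives multiplies it by fourth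
    roots of unity. *)
Lemma wedge_orb2 u v u' v' : u != 0 -> v != 0 -> u' != 0 -> v' != 0 ->
  orb2 u' v' = orb2 u v -> wedge u' v' ^+ 4 = wedge u v ^+ 4.
Proof.
move=> u0 v0 u0' v0' /orb2_eqP[] // A AS [].
case/pt_eq; rewrite ?GL_neq0 // => c c4 ->.
case/pt_eq; rewrite ?GL_neq0 // => d d4 ->.
by rewrite wedgeZl wedgeZr SL2_wedge // !exprMn c4 d4 !mul1r.
Qed.

Lemma orb2_wedge_eq (c d : F) : c != 0 -> d != 0 ->
  orb2 (vec 1 0) (vec 0 c) = orb2 (vec 1 0) (vec 0 d) <-> c ^+ 4 = d ^+ 4.
Proof.
move=> c0 d0; have n0 b : b != 0 -> vec 0 b != 0 :> 'cV[F]_2.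
  by move=> b0; rewrite col2_neq0 vecE1 b0 orbT.
split=> [/wedge_orb2|cd].
  by rewrite vec10_neq0 !n0 // /wedge !vecE0 !vecE1 !mul1r !mul0r !subr0; apply.
congr (orbit _ _ (_, _)); apply/pt_eq; rewrite ?n0 //; exists (c / d).
  by rewrite exprMn exprVn cd divff // expf_neq0.
by apply: colP2; rewrite [RHS]mxE !(vecE0, vecE1) ?mulr0 ?divfK.
Qed.

(** The determinant vanishes on both pairs, so the ratio of the two vectors is compared instead. *)
Lemma orb2_collinear_eq (c d : F) : c != 0 -> d != 0 ->
  orb2 (vec 1 0) (vec c 0) = orb2 (vec 1 0) (vec d 0) <-> c ^+ 4 = d ^+ 4.
Proof.
move=> c0 d0; have n0 b : b != 0 -> vec b 0 != 0 :> 'cV[F]_2.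
  by move=> b0; rewrite col2_neq0 vecE0 b0.
have vecZ b : vec b 0 = b *: vec 1 0 :> 'cV[F]_2.
  by apply: colP2; rewrite [RHS]mxE !(vecE0, vecE1) ?mulr0 ?mulr1.
split=> [/orb2_eqP[]|cd]; rewrite ?vec10_neq0 ?n0 //.
  move=> A AS []; case/pt_eq; rewrite ?GL_neq0 ?vec10_neq0 // => a a4 ea.
  have GLw : (GLval A *m vec 1 0 == 0) = false.
    by apply: negbTE; rewrite GL_neq0 vec10_neq0.
  case/pt_eq; rewrite ?GL_neq0 ?n0 // => b b4.
  (* Both sides become multiples of [GLval A *m vec 1 0], which gives c a = b d with a and b fourth
     roots of unity. *)
  rewrite [vec d 0]vecZ [vec c 0]vecZ -scalemxAr {1}ea !scalerA => /eqP.
  rewrite -subr_eq0 -scalerBl scaler_eq0 GLw orbF subr_eq0.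
  move=> /eqP/(congr1 (fun t => t ^+ 4)).
  by rewrite !exprMn a4 b4 !mulr1 mul1r.
congr (orbit _ _ (_, _)); apply/pt_eq; rewrite ?n0 //; exists (c / d).
  by rewrite exprMn exprVn cd divff // expf_neq0.
by apply: colP2; rewrite [RHS]mxE !(vecE0, vecE1) ?mulr0 ?divfK.
Qed.

Lemma orb2_wedge_collinear (c d : F) : c != 0 -> d != 0 ->
  orb2 (vec 1 0) (vec 0 c) <> orb2 (vec 1 0) (vec d 0).
Proof.
move=> c0 d0 /wedge_orb2; rewrite vec10_neq0 !col2_neq0 !vecE0 !vecE1 c0 d0 orbT.
rewrite /wedge !vecE0 !vecE1 !mul1r mul0r mulr0 !subr0 expr0n /=.
move=> /(_ isT isT isT isT)/eqP.
by rewrite expf_eq0 (negPf c0).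
Qed.

End Points.

(** * Characteristic 5: blocks as projective lines over the prime field *)

Section F5.

Variables (F : finFieldType) (i : {unit F}).
Hypotheses (char5 : 5%N \in [pchar F]) (i2 : FinRing.uval i ^+ 2 = -1).
Implicit Types (u v : 'cV[F]_2) (A : {'GL_2[F]}) (p x y : point i).
Local Notation e := (FinRing.uval i).
Local Notation pt := (@pt F i).

(** The prime subfield F_5 of F. *)
Definition fixF5 (c : F) := c ^+ 5 == c.

Lemma fixF5P c : reflect (c = 0 \/ c ^+ 4 = 1) (fixF5 c).
Proof.
have -> : fixF5 c = (c == 0) || (c ^+ 4 == 1).
  by rewrite /fixF5 -subr_eq0 exprS -[X in _ - X]mulr1 -mulrBr mulf_eq0 subr_eq0.
by apply: (iffP orP) => -[/eqP|/eqP]; [left|right|move=> ->; left|move=> ->; right].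
Qed.

(** In characteristic 5 the map c -> c^5 is the Frobenius endomorphism, so its fixed elements form a
    subfield. *)
Lemma fixF5D c d : fixF5 c -> fixF5 d -> fixF5 (c + d).
Proof.
move=> /eqP c5 /eqP d5.
by rewrite /fixF5 -(pFrobenius_autE char5) rmorphD /= !pFrobenius_autE c5 d5.
Qed.

Lemma fixF5M c d : fixF5 c -> fixF5 d -> fixF5 (c * d).
Proof. by rewrite /fixF5 exprMn => /eqP-> /eqP->. Qed.

Lemma fixF5N c : fixF5 c -> fixF5 (- c).
Proof. 
move=> /eqP c5.
by rewrite /fixF5 -(pFrobenius_autE char5) rmorphN /= pFrobenius_autE c5.
Qed.

Lemma fixF5V c : fixF5 c -> fixF5 c^-1.
Proof. by rewrite /fixF5 exprVn => /eqP->. Qed.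

Lemma fixF5_nat n : fixF5 n%:R.
Proof. by rewrite /fixF5 -(pFrobenius_autE char5) rmorph_nat. Qed.

Lemma five0 : 5%:R = 0 :> F. Proof. exact: pcharf0. Qed.

Lemma natr_mod5 a b : a = b %[mod 5] -> a%:R = b%:R :> F.
Proof. by move=> ab; rewrite -(GRing.natr_mod_pchar char5) ab GRing.natr_mod_pchar. Qed.

(** Modulo 5 the polynomial X^2 + 1 factors as (X - 2)(X - 3). *)
Lemma i_2or3 : e = 2%:R \/ e = 3%:R.
Proof.
have: (e - 2%:R) * (e - 3%:R) == 0.
  have -> : (e - 2%:R) * (e - 3%:R) = e ^+ 2 + 1 + 5%:R * (1 - e) by ring.
  by rewrite i2 five0 mul0r addr0 addNr.
by rewrite mulf_eq0 !subr_eq0 => /orP[]/eqP->; [left|right].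
Qed.

Lemma fixF5_natP c : fixF5 c -> exists2 k, (k < 5)%N & c = k%:R.
Proof.
move/fixF5P=> [->|/eqP]; first by exists 0%N.
rewrite (expr4_eq1 i2).
have N a b : (a + b = 5)%N -> - a%:R = b%:R :> F.
  by move=> ab; apply/eqP; rewrite eq_sym -addr_eq0 -natrD addnC ab five0.
case: i_2or3 => ->; rewrite -[X in - X](mulr1n 1) !(N 1%N 4%N, N 2%N 3%N, N 3%N 2%N) //.
- by case/or4P=> /eqP->; [exists 1%N|exists 4%N|exists 2%N|exists 3%N].
- by case/or4P=> /eqP->; [exists 1%N|exists 4%N|exists 3%N|exists 2%N].
Qed.

(** Coordinates are kept as natural numbers, so that questions about vectors over F_5 are settled by
    computation modulo 5. *)
Definition nvec (k : nat * nat) : 'cV[F]_2 := vec k.1%:R k.2%:R.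

(** [i] may be either square root of -1 in F_5, namely 2 or 3; each choice gives
    different representatives of the same six points. *)
Lemma base_block_nat : exists2 s : seq (nat * nat),
  s \in [:: [:: (1, 0); (0, 1); (1, 1); (3, 1); (2, 1); (1, 4)];
            [:: (1, 0); (0, 1); (1, 1); (4, 1); (3, 1); (1, 3)]]%N &
  base_block i = [set p | val p \in [seq ray i (nvec k) | k <- s]].
Proof.
have N a b c : (a = b + c %[mod 5])%N -> a%:R - b%:R = c%:R :> F.
  by move=> /natr_mod5 ->; rewrite natrD addrAC subrr add0r.
case: i_2or3 => ei.
- exists [:: (1, 0); (0, 1); (1, 1); (3, 1); (2, 1); (1, 4)]%N => //.
  by rewrite /base_block ei -[1]/(1%:R) -natrD (N 1 2 4)%N.
- exists [:: (1, 0); (0, 1); (1, 1); (4, 1); (3, 1); (1, 3)]%N => //.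
  by rewrite /base_block ei -[1]/(1%:R) -natrD (N 1 3 3)%N.
Qed.

(** The factor 4 stands for -1 modulo 5, which avoids truncated subtraction. *)
Lemma wedge_nvec_neq0 k l : ~~ (5 %| k.1 * l.2 + 4 * (l.1 * k.2))%N ->
  wedge (nvec k) (nvec l) != 0.
Proof.
rewrite (dvdn_pcharf char5) natrD !natrM /wedge /nvec !vecE0 !vecE1.
suff -> : forall a b : F, a + 4%:R * b = a - b + 5%:R * b.
  by rewrite five0 mul0r addr0.
by move=> a b; ring.
Qed.

Lemma ray_eq_wedge u v : ray i u = ray i v -> wedge u v = 0.
Proof. by case/(ray_eq i2)=> c _ ->; rewrite wedgeZl /wedge subrr mulr0. Qed.

(** The six representatives have pairwise nonzero determinants, by computation modulo 5, so their
    rays are distinct. *)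
Lemma card_base_block : #|base_block i| = 6%N.
Proof.
have [s ss ->] := base_block_nat.
have us : uniq [seq ray i (nvec k) | k <- s].
  rewrite uniq_pairwise pairwise_map.
  have : pairwise (fun k l : nat * nat => ~~ (5 %| k.1 * l.2 + 4 * (l.1 * k.2)))%N s.
    by move: ss; rewrite !inE => /orP[]/eqP->.
  apply: sub_pairwise => k l /= kl; apply: contraNneq (wedge_nvec_neq0 kl).
  by move/ray_eq_wedge->.
have s0 k : k \in s -> nvec k != 0.
  have : all (fun k : nat * nat => ~~ (5 %| k.1) || ~~ (5 %| k.2))%N s.
    by move: ss; rewrite !inE => /orP[]/eqP->.
  by move=> /allP s0 /s0; rewrite col2_neq0 vecE0 vecE1 !(dvdn_pcharf char5).
transitivity (size [seq ray i (nvec k) | k <- s]); last first.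
  by move: ss; rewrite !inE => /orP[]/eqP->.
rewrite -(card_uniqP us) -(card_imset _ val_inj); apply: eq_card => R.
apply/imsetP/idP=> [[p /[!inE] ps ->]//|/[dup] Rs /mapP[k ks ek]].
by exists (pt (nvec k)); rewrite ?inE !val_pt ?s0 // -ek.
Qed.

(** The six vectors represent all points of the projective line over F_5: a vector with coordinates
    in F_5 is a multiple of (1, 0) or of some (k, 1), and the multiplier is a fourth root of
    unity. *)
Lemma mem_base_block v : v != 0 ->
  (pt v \in base_block i) = fixF5 (v 0 0) && fixF5 (v 1 0).
Proof.
move=> v0; have [s ss ->] := base_block_nat; rewrite inE val_pt //.
apply/mapP/andP=> [[k _ /(ray_eq i2)[c c4 ->]]|[f0 f1]].
  have fc : fixF5 c by apply/fixF5P; right.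
  by rewrite !mxE /=; split; rewrite fixF5M ?fixF5_nat.
have [v10|v10] := eqVneq (v 1 0) 0.
  exists (1, 0)%N; first by move: ss; rewrite !inE => /orP[]/eqP->.
  move/fixF5P: f0 => [v00|v00]; first by rewrite col2_neq0 v00 v10 eqxx in v0.
  apply/ray_eq => //; exists (v 0 0) => //.
  by apply: colP2; rewrite [RHS]mxE ?vecE0 ?vecE1 ?mulr0 ?mulr1.
have v14 : v 1 0 ^+ 4 = 1 by case/fixF5P: f1 => // v1; rewrite v1 eqxx in v10.
have [k k5 ek] := fixF5_natP (fixF5M f0 (fixF5V f1)).
have ev : v = v 1 0 *: nvec (k, 1%N).
  by apply: colP2; rewrite [RHS]mxE ?vecE0 ?vecE1 ?mulr1 // -ek mulrC divfK.
(* A finite search over k: some listed [l] and some m with m^4 = 1 modulo 5 satisfy (k, 1) = m l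
   modulo 5. *)
have : has (fun l : nat * nat =>
    has (fun m => [&& k == m * l.1 %[mod 5], 1 == m * l.2 %[mod 5]
      & m ^ 4 == 1 %[mod 5]]) (iota 0 5))%N s.
  by move: ss k5; rewrite !inE => /orP[]/eqP->; case: k {ek ev} => [|[|[|[|[]]]]].
case/hasP=> l ls /hasP[m _ /and3P[/eqP e1 /eqP e2 /eqP e3]].
exists l => //; apply/ray_eq=> //; exists (v 1 0 * m%:R).
  by rewrite exprMn v14 -natrX (natr_mod5 e3) mulr1.
rewrite {1}ev -scalerA; congr (_ *: _).
by apply: colP2; rewrite [RHS]mxE ?vecE0 ?vecE1 -natrM; apply: natr_mod5.
Qed.

Local Notation blk A := ((psl_action i)^*%act (base_block i) (coset (pmI F) A)).

Lemma blocksP B : reflect (exists2 A, A \in SL2 F & B = blk A) (B \in blocks i).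
Proof.
apply: (iffP idP) => [/imsetP[_ /PSL2P[A AS ->] ->]|[A AS ->]]; first by exists A.
by apply: imset_f; apply/PSL2P; exists A.
Qed.

(** Under the right action [blk A] is the image of the base block by the inverse of [A], so
    membership is tested after applying [A]. *)
Lemma mem_blk A v : v != 0 ->
  (pt v \in blk A) = fixF5 ((GLval A *m v) 0 0) && fixF5 ((GLval A *m v) 1 0).
Proof.
move=> v0; rewrite -mem_base_block ?GL_neq0 //.
rewrite -[in LHS](GLvalKV A v) -(psl_pt i2) ?GL_neq0 //.
exact: (mem_imset _ _ (act_inj (psl_action i) _)).
Qed.

Lemma card_blocks_elt B : B \in blocks i -> #|B| = 6%N.
Proof. by case/blocksP=> A _ ->; rewrite card_setact card_base_block. Qed.

(** Moved into the base block, both vectors have coordinates in F_5, and so does their determinant.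
    If it were 0, the vectors would differ by a nonzero factor in F_5 and represent the same
    point. *)
Lemma wedge_block B u v : B \in blocks i -> u != 0 -> v != 0 ->
  pt u != pt v -> pt u \in B -> pt v \in B -> wedge u v ^+ 4 = 1.
Proof.
case/blocksP=> A AS -> u0 v0 uv; rewrite !mem_blk // => /andP[u1 u2] /andP[v1 v2].
rewrite -(SL2_wedge u v AS); set u' := _ *m u; set v' := _ *m v.
have : fixF5 (wedge u' v') by rewrite fixF5D ?fixF5M // fixF5N ?fixF5M.
case/fixF5P=> // w0; case/eqP: uv; apply/pt_eq => //.
have [||c ec] := @wedge_eq0 _ v' u'; first by rewrite GL_neq0.
  by apply/eqP; rewrite -oppr_eq0 -w0; apply/eqP; rewrite /wedge; ring.
(* The factor is a quotient of coordinates in F_5, taken at a nonzero coordinate of [v']. *)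
have fc : fixF5 c.
  have : v' != 0 by rewrite GL_neq0.
  rewrite col2_neq0 => /orP[]v0'.
    have -> : c = u' 0 0 / v' 0 0 by rewrite ec mxE mulfK.
    by rewrite fixF5M ?fixF5V.
  have -> : c = u' 1 0 / v' 1 0 by rewrite ec mxE mulfK.
  by rewrite fixF5M ?fixF5V.
exists c; last by rewrite -(GLvalKV A u) -/u' ec -scalemxAr GLvalKV.
case/fixF5P: fc => // c0; move: u0; rewrite -(GL_neq0 A) -/u' ec c0 scale0r.
by rewrite eqxx.
Qed.

(** The matrix with columns [u] and [v] maps the base block to the F_5-span of [u] and [v]. Any
    other block containing both points is shown to have the same members, by comparing coordinates
    relative to [u] and [v]. *)
Lemma unique_block1 u v : wedge u v = 1 ->
  #|[set B in blocks i | (pt u \in B) && (pt v \in B)]| = 1%N.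
Proof.
move=> w1; have w0 : wedge u v != 0 by rewrite w1 oner_eq0.
have u0 := wedge_neq0l w0; have v0 := wedge_neq0r w0.
have [A AS Ae] := SL2_columns w1.
have Au : GLval A *m vec 1 0 = u by rewrite Ae scale1r scale0r addr0.
have Av : GLval A *m vec 0 1 = v by rewrite Ae scale1r scale0r add0r.
have f0 : fixF5 0 by apply: (fixF5_nat 0).
have f1 : fixF5 1 by apply: (fixF5_nat 1).
rewrite -(cards1 (blk A^-1)); apply: eq_card => B; rewrite !inE.
apply/andP/eqP=> [[/blocksP[A' AS' ->]]|->]; last first.
  split; first by apply/blocksP; exists A^-1%g; rewrite ?groupV.
  by rewrite !mem_blk // -Au -Av !GLvalKV !vecE0 !vecE1 f0 f1.
rewrite !mem_blk //; set u' := _ *m u; set v' := _ *m v.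
case/andP=> /andP[u1 u2] /andP[v1 v2].
have w1' : wedge u' v' = 1 by rewrite SL2_wedge.
apply/setP=> p; have [t t0 ->] := ptP p; rewrite !mem_blk //.
set a := (GLval A^-1 *m t) 0 0; set b := (GLval A^-1 *m t) 1 0.
have et : t = a *: u + b *: v.
  by rewrite -Ae -[LHS](GLvalVK A); congr (_ *m _); apply: colP2; rewrite ?vecE0 ?vecE1.
have et' : GLval A' *m t = a *: u' + b *: v' by rewrite et mulmxDr !scalemxAr.
(* By Cramer's rule the coordinates of [t] are determinants involving [u'], [v'] and
   [GLval A' *m t], hence lie in F_5 when the entries of the latter do. *)
have ea : a = wedge (GLval A' *m t) v'.
  rewrite et' -[LHS]mulr1 -w1' /wedge !mxE; ring.
have eb : b = wedge u' (GLval A' *m t).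
  rewrite et' -[LHS]mulr1 -w1' /wedge !mxE; ring.
apply/andP/andP=> -[g1 g2].
  by rewrite ea eb !fixF5D ?fixF5M ?fixF5N ?fixF5M.
(* Generalizing [u'] and [v'] keeps [mxE] from expanding them as matrix products. *)
rewrite et'; move: (u') (v') u1 u2 v1 v2 => s s' s0 s1 s0' s1'.
by rewrite !mxE !fixF5D ?fixF5M.
Qed.

(** Dividing [v] by the determinant, a fourth root of unity, keeps its point and reduces to
    determinant 1. *)
Lemma unique_block u v : wedge u v ^+ 4 = 1 ->
  #|[set B in blocks i | (pt u \in B) && (pt v \in B)]| = 1%N.
Proof.
move=> w4; have w0 := expr4_neq0 w4.
have w14 : (wedge u v)^-1 ^+ 4 = 1 by rewrite exprVn w4 invr1.
rewrite -(pt_scale i2 w14 (wedge_neq0r w0)).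
by apply: unique_block1; rewrite wedgeZr mulVf.
Qed.

End F5.

(** * Counting points, orbits on pairs, and blocks *)

Section Counting.

Variables (F : finFieldType) (i : {unit F}).
Hypotheses (char5 : 5%N \in [pchar F]) (i2 : FinRing.uval i ^+ 2 = -1).
Implicit Types (u v : 'cV[F]_2) (A : {'GL_2[F]}) (p x y : point i).
Local Notation e := (FinRing.uval i).
Local Notation pt := (@pt F i).
Local Notation orb2 u v :=
  (orbit (pair_action (psl_action i)) (PSL2 F) (pt u, pt v)).

Lemma order_i : #[i]%g = 4%N.
Proof.
have d4 : (#[i]%g %| 4)%N.
  by rewrite order_dvdn; apply/eqP/val_inj; rewrite [LHS]FinRing.val_unitX (i4 i2).
have n2 : ~~ (#[i]%g %| 2)%N.
  rewrite order_dvdn; apply/eqP=> /(congr1 FinRing.uval).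
  rewrite FinRing.val_unitX i2 => /eqP.
  rewrite eq_sym -addr_eq0 -[_ + _]/(1%:R + 1%:R) -natrD.
  by rewrite -(dvdn_pcharf char5).
have := dvdn_leq (isT : (0 < 4)%N) d4; move: d4 n2.
by case: #[i]%g => [|[|[|[|[|]]]]].
Qed.

Lemma card_ray v : v != 0 -> #|ray i v| = 4%N.
Proof.
move=> v0; rewrite -order_i /ray card_in_imset // => z z' _ _ /eqP.
by rewrite -subr_eq0 -scalerBl scaler_eq0 (negPf v0) orbF subr_eq0 => /eqP/val_inj.
Qed.

(** The nonzero vectors are partitioned by [pt] into fibres, each a ray of four vectors. *)
Lemma card_point : (#|{: point i}| * 4 = #|F| ^ 2 - 1)%N.
Proof.
have -> : (#|F| ^ 2 - 1)%N = #|[set v : 'cV[F]_2 | v != 0]|.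
  rewrite -[X in _ = X](_ : #|predC1 (0 : 'cV[F]_2)| = _).
    by rewrite cardC1 card_mx muln1 subn1.
  by apply: eq_card => v; rewrite !inE.
rewrite -sum1_card (partition_big pt predT) //= -sum_nat_const.
apply: eq_bigr => p _; have [v v0 ->] := ptP p; rewrite -(card_ray v0) -sum1_card.
apply: eq_bigl => u; rewrite inE; apply/idP/andP => [|[u0 /eqP/esym]].
  case/(mem_ray i2)=> c c4 ->; rewrite scaler_eq0 negb_or v0 expr4_neq0 //.
  by rewrite pt_scale.
by move/(congr1 val); rewrite !val_pt // => ->; apply/mem_ray => //; exists 1;
   rewrite ?expr1n ?scale1r.
Qed.

(** Both images are in bijection with the set of pairs [(f t, g t)] through the projections. *)
Lemma card_imset_eq (T T1 T2 : finType) (f : T -> T1) (g : T -> T2) :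
  (forall s t, f s = f t <-> g s = g t) -> #|[set f t | t : T]| = #|[set g t | t : T]|.
Proof.
move=> fg; pose G := [set (f t, g t) | t : T].
have -> : [set f t | t : T] = fst @: G by rewrite -imset_comp.
have -> : [set g t | t : T] = snd @: G by rewrite -imset_comp.
have [-> ->] // : #|fst @: G| = #|G| /\ #|snd @: G| = #|G|.
split; apply: card_in_imset => _ _ /imsetP[s _ ->] /imsetP[t _ ->] /= st.
  by rewrite st; move/fg: st => ->.
by rewrite st; move/fg: st => ->.
Qed.

(** An orbit is determined by a boolean, telling nonzero determinant ([true]) from collinearity
    ([false]), and by a coset of [<[i]>]; this gives twice the index of [<[i]>] in the unit
    group. *)
Lemma card_schurian_relations :
  #|schurian_relations (psl_action i) (PSL2 F)| = (2 * (#|F|.-1 %/ 4))%N.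
Proof.
pose f (bc : bool * {unit F}) : {set point i * point i} :=
  let c := FinRing.uval bc.2 in
  if bc.1 then orb2 (vec 1 0) (vec 0 c) else orb2 (vec 1 0) (vec c 0).
have unit_neq0 (c : {unit F}) : FinRing.uval c != 0 by rewrite -unitfE (valP c).
have -> : schurian_relations (psl_action i) (PSL2 F) = [set f bc | bc : bool * {unit F}].
  apply/setP=> S; apply/imsetP/imsetP=> [[[x y] _ ->]|[[b c] _ ->]]; last first.
    by rewrite /f; case: b; eexists.
  have [u u0 ->] := ptP x; have [v v0 ->] := ptP y.
  have [w0|w0] := eqVneq (wedge u v) 0.
    have [c ec] := wedge_eq0 u0 w0.
    have c0 : c != 0 by apply: contraNneq v0 => c0; rewrite ec c0 scale0r.
    have cU : c \is a GRing.unit by rewrite unitfE.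
    by exists (false, Sub c cU : {unit F}) => //; rewrite /f /= ec orb2_collinear.
  have wU : wedge u v \is a GRing.unit by rewrite unitfE.
  by exists (true, Sub (wedge u v) wU : {unit F}) => //; rewrite /f /= (orb2_wedge i2 w0).
pose g (bc : bool * {unit F}) := (bc.1, (<[i]> :* bc.2)%g).
have fg : forall s t, f s = f t <-> g s = g t.
  have cos (c d : {unit F}) :
      FinRing.uval c ^+ 4 = FinRing.uval d ^+ 4 <-> (<[i]> :* c = <[i]> :* d)%g.
    split=> [cd|/rcoset_eqP].
      apply/rcoset_eqP; rewrite mem_rcoset.
      have : FinRing.uval (c * d^-1)%g ^+ 4 = 1.
        by rewrite FinRing.val_unitM FinRing.val_unitV exprMn exprVn cd divff ?expf_neq0.
      by move/(mem_cycle_i i2)=> [z zi /val_inj <-].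
    rewrite mem_rcoset => H.
    have : FinRing.uval (c * d^-1)%g ^+ 4 = 1.
      by apply/(mem_cycle_i i2); exists (c * d^-1)%g.
    rewrite FinRing.val_unitM FinRing.val_unitV exprMn exprVn => /divr1_eq.
    exact.
  move=> [[] c] [[] d]; rewrite /f /g /=.
  - by rewrite orb2_wedge_eq // cos; split=> [->|[]].
  - by split=> // /orb2_wedge_collinear[].
  - by split=> // /esym /orb2_wedge_collinear[].
  - by rewrite orb2_collinear_eq // cos; split=> [->|[]].
rewrite (card_imset_eq fg).
have -> : [set g t | t : bool * {unit F}] =
    setX [set: bool] (rcosets <[i]> [set: {unit F}])%g.
  apply/setP=> -[b S]; apply/imsetP/setXP=> [[[b' c] _ [-> ->]]|[_ /rcosetsP[c _ ->]]].
    by split=> //; apply/rcosetsP; exists c.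
  by exists (b, c).
rewrite cardsX cardsT card_bool -[#|rcosets _ _|]/(#|[set: {unit F}] : <[i]>|)%g.
by rewrite -divgS ?subsetT // card_finField_unit -orderE order_i.
Qed.

(** The pairs whose determinant lies in F_5^*, which will be the first associates. *)
Definition wedge_relation : {set point i * point i} := orb2 (vec 1 0) (vec 0 1).

Lemma mem_wedge_relation u v : u != 0 -> v != 0 ->
  ((pt u, pt v) \in wedge_relation) = (wedge u v ^+ 4 == 1).
Proof.
move=> u0 v0; have n0 : vec 0 1 != 0 :> 'cV[F]_2 by rewrite vec01_neq0.
have -> : ((pt u, pt v) \in wedge_relation) = (orb2 u v == wedge_relation).
  by apply/idP/eqP=> [/(orbit_in_eqP (to := pair_action (psl_action i)) (PSL2_dom F))|<-];
     rewrite ?orbit_refl.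
apply/eqP/eqP=> [/(wedge_orb2 i2)|w4].
  rewrite u0 v0 vec10_neq0 n0 => -> //.
  by rewrite /wedge !vecE0 !vecE1 !mul1r mul0r subr0 expr1n.
have w0 := expr4_neq0 w4; rewrite (orb2_wedge i2 w0) //.
by apply/(orb2_wedge_eq i2); rewrite ?oner_eq0 ?expr1n.
Qed.

Lemma card_common_blocks x y : x != y ->
  #|[set B in blocks i | (x \in B) && (y \in B)]| = ((x, y) \in wedge_relation).
Proof.
have [u u0 ->] := ptP x; have [v v0 ->] := ptP y => xy.
rewrite mem_wedge_relation //; have [w4|w4] := eqVneq; first exact: unique_block.
apply: eq_card0 => B; rewrite !inE; apply/and3P=> [[Bi Bx By]].
by case/eqP: w4; apply: wedge_block Bi _ _ _ Bx By.
Qed.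

Lemma diag_wedge_relation x : (x, x) \notin wedge_relation.
Proof.
have [u u0 ->] := ptP x; rewrite mem_wedge_relation //.
by rewrite /wedge subrr expr0n eq_sym oner_eq0.
Qed.

(** With [wedge u v = 1], each neighbour of [pt u] has exactly one representative of the form
    [v + a *: u]: rescaling makes the determinant with [u] equal to 1, and [a] is then free in F. *)
Lemma card_wedge_neighbours x : #|[set y | (x, y) \in wedge_relation]| = #|F|.
Proof.
have [u u0 ->] := ptP x; have [v uv] := exists_wedge1 u0.
have uvZ a : wedge u (v + a *: u) = 1 by rewrite -uv /wedge !mxE; ring.
have n0 a : v + a *: u != 0 by apply: (@wedge_neq0r _ u); rewrite uvZ oner_eq0.
have inj : injective (fun a => pt (v + a *: u)).
  move=> a b /(pt_eq i2 (n0 a) (n0 b)) [c _ ec].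
  have c1 : c = 1 by rewrite -(uvZ a) ec wedgeZr uvZ mulr1.
  move: ec; rewrite c1 scale1r => /addrI/eqP; rewrite -subr_eq0 -scalerBl scaler_eq0.
  by rewrite (negPf u0) orbF subr_eq0 => /eqP.
rewrite -(card_imset _ inj); apply: eq_card => y; rewrite inE.
apply/idP/imsetP=> [|[a _ ->]]; last first.
  by rewrite mem_wedge_relation ?n0 // uvZ expr1n.
have [t t0 ->] := ptP y; rewrite mem_wedge_relation // => /eqP w4.
have w0 := expr4_neq0 w4; exists (wedge t v / wedge u t) => //.
have {1}-> : t = wedge u t *: (v + (wedge t v / wedge u t) *: u).
  by rewrite scalerDr scalerA mulrCA divff // mulr1 addrC -wedge_decomp.
by rewrite pt_scale.
Qed.

(** Count pairs of a block through [x] and another point [y] on it: every block has five such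
    points, and every neighbour of [x] lies on exactly one block with it. *)
Lemma card_blocks_through x : (5 * #|[set B in blocks i | x \in B]| = #|F|)%N.
Proof.
rewrite -(card_wedge_neighbours x).
have -> : #|[set y | (x, y) \in wedge_relation]| =
    (\sum_(y | y != x) #|[set B in blocks i | (x \in B) && (y \in B)]|)%N.
  rewrite -sum1_card big_mkcond [RHS]big_mkcond; apply: eq_bigr => y _.
  rewrite inE; have [->|yx] := eqVneq y x.
    by rewrite (negPf (diag_wedge_relation x)).
  by rewrite card_common_blocks 1?eq_sym //; case: (_ \in _).
rewrite mulnC -sum_nat_const.
transitivity (\sum_(B in [set B in blocks i | x \in B])
                \sum_(y | (y != x) && (y \in B)) 1)%N.
  apply: eq_bigr => B; rewrite inE => /andP[Bi Bx]; rewrite sum1_card.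
  have := card_blocks_elt char5 i2 Bi; rewrite (cardsD1 x) Bx => -[<-].
  by apply: eq_card => y; rewrite !inE.
rewrite (exchange_big_dep (fun y => y != x)) /=; last by move=> B y _ /andP[].
apply: eq_bigr => y yx; rewrite sum1_card; apply: eq_card => B.
by rewrite unfold_in yx !inE -andbA.
Qed.

(** Count incident pairs of a point and a block with weight 5: a point contributes [#|F|] and a
    block 6 * 5. *)
Lemma card_blocks : (30 * #|blocks i| = #|{: point i}| * #|F|)%N.
Proof.
have -> : (#|{: point i}| * #|F| =
    \sum_(x : point i) \sum_(B in [set B in blocks i | x \in B]) 5)%N.
  rewrite -sum_nat_const; apply: eq_bigr => x _.
  by rewrite sum_nat_const mulnC card_blocks_through.
rewrite (exchange_big_dep (mem (blocks i))) /=; last first.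
  by move=> x B _; rewrite inE => /andP[].
rewrite mulnC -sum_nat_const; apply: eq_bigr => B Bi.
rewrite sum_nat_const -[(30)%N]/(6 * 5)%N -(card_blocks_elt char5 i2 Bi); congr (_ * _)%N.
apply: eq_card => x.
by rewrite [RHS](_ : _ = (B \in [set B' in blocks i | x \in B'])) // inE Bi.
Qed.

End Counting.

End PSL2Design.

(** * Numbering of the relations and verification of the parameters *)

Theorem theorem2p11 (alpha : nat) (F : finFieldType) (w : {unit F}) :
  let q := (5 ^ alpha)%N in
  let i := sqrtN1 w in
  let m := ((q - 3) %/ 2)%N in
  (1 <= alpha)%N ->
  #|F| = q ->
  generator [set: {unit F}] w ->
  (q %/ 5)%N = (5 ^ (alpha - 1))%N /\
  exists R : 'I_m.+1 -> {set point i * point i},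
    [set R j | j : 'I_m.+1] = schurian_relations (psl_action i) (PSL2 F) /\
    GPBIBD (blocks i) R
      ((q ^ 2 - 1) %/ 4) ((q * (q ^ 2 - 1)) %/ 120) 6 (q %/ 5)
      (fun j => if j == 1%N then 1%N else 0%N).
Proof.
move=> q i m a1 cF genw; split.
  by rewrite /q; case: alpha a1 {q cF i m} => // a _; rewrite expnS mulKn // subn1.
have [d4 _ _ _ _] := parameters_exact a1; rewrite -/q in d4.
have q5 : (5 <= q)%N by rewrite -[5%N]/(5 ^ 1)%N leq_exp2l.
have char5 : 5%N \in [pchar F]%R.
  exact: (finfield.card_finPcharP cF).
have i2 : (FinRing.uval i ^+ 2 = -1)%R.
  by rewrite -FinRing.val_unitX; apply: sqrtN1_sqr; rewrite ?cF.
have cS : #|schurian_relations (psl_action i) (PSL2 F)| = m.+1.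
  (* Since 4 divides q - 1, 2 ((q - 1) / 4) = (q - 3) / 2 + 1. *)
  rewrite card_schurian_relations // cF /m; case/dvdnP: d4 => k; lia.
have m0 : (0 < m)%N by rewrite /m; lia.
pose x0 : point i := pt i (vec 1 0)%R.
(* The diagonal is a single orbit because the group is transitive on points. *)
have diag_orbit : [set (x, x) | x : point i] =
    orbit (pair_action (psl_action i)) (PSL2 F) (x0, x0).
  have v0 := vec10_neq0 F.
  apply/setP=> p; apply/imsetP/idP=> [[x _ ->]|/orbitP[g _ <-]].
    have [u u0 ->] := ptP x; have [v] := exists_wedge1 u0.
    case/SL2_columns=> A AS Ae; apply/orbit_pairP => //.
    by exists A => //; rewrite Ae GRing.scale1r GRing.scale0r GRing.addr0.
  by exists (psl_action i x0 g).
have diag_in : [set (x, x) | x : point i] \in schurian_relations (psl_action i) (PSL2 F).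
  by rewrite diag_orbit; apply: imset_f.
have wedge_in : wedge_relation i \in schurian_relations (psl_action i) (PSL2 F).
  exact: imset_f.
have diag_wedge : [set (x, x) | x : point i] != wedge_relation i.
  apply/eqP=> dw; have := diag_wedge_relation i2 x0.
  by rewrite -dw => /negP; apply; apply: imset_f.
have [R [injR imR R0 R1]] := enum_starting_with cS m0 diag_in wedge_in diag_wedge.
have scheme := orbits_association_scheme (PSL2_dom F) injR imR R0.
exists R; split=> //; split=> //.
- by rewrite -cF -(card_point char5 i2) mulnK.
- have := card_blocks char5 i2; have := card_point char5 i2; rewrite cF => <-.
  (* From 30 b = v q and 4 v = q^2 - 1 follows 120 b = q (q^2 - 1). *)
  by move=> e; rewrite (_ : q * _ = #|blocks i| * 120)%N ?mulnK //; lia.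
- by move=> B; apply: card_blocks_elt.
- by move=> x; rewrite -cF -(card_blocks_through char5 i2 x) mulKn.
- move=> j j1 x y xyj.
  have [_ tI _] := and3P (scheme_partition scheme).
  (* The relations are disjoint, so a pair in [R j] is off the diagonal when j > 0, and is in
     [wedge_relation i] only if j = 1. *)
  have disj k : k != j -> (x, y) \notin R k.
    move=> kj; apply: contraNN kj => xyk; apply/eqP/injR.
    move/trivIsetP: tI => /(_ (R k) (R j)); rewrite !imset_f // => /(_ isT isT).
    case: eqVneq => // _ /(_ isT); rewrite -setI_eq0 => /eqP/setP/(_ (x, y)).
    by rewrite !inE xyk xyj.
  have xy : x != y.
    apply: contraNneq (disj ord0 _) => [->|]; first by rewrite R0; apply: imset_f.
    by rewrite -val_eqE /= eq_sym -lt0n.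
  rewrite card_common_blocks // -R1; case: eqVneq => [<-|Rj]; first by rewrite xyj.
  have : wedge_relation i \in [set R j | j : 'I_m.+1] by rewrite imR.
  case/imsetP=> k _ Rk; rewrite Rk (negPf (disj k _)) //.
  by apply: contraNneq Rj => <-; rewrite Rk.
Qed.
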